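(* For every semigroup $S$, any non-zero cardinal $\lambda$ and any positive integer $n\leqslant\lambda$ the following statements hold: (i) $\mathscr{I}_\lambda^n(S)$ is right stable if and only if $S$ is right stable; (ii) $\mathscr{I}_\lambda^n(S)$ is left stable if and only if $S$ is left stable; (iii) $\mathscr{I}_\lambda^n(S)$ is stable if and only if $S$ is stable.
   Context: A semigroup $T$ is left stable if for all $a,b\in T$, $Ta\subseteq Tab$ implies $Ta=Tab$; right stable if for all $c,d\in T$, $cT\subseteq dcT$ implies $cT=dcT$; stable if it is both left and right stable. $\mathscr{I}_\lambda^n$ is the semigroup of all partial injective maps $\lambda\rightharpoonup\lambda$ of rank (cardinality of the range) at most $n$, with composition $x(\alpha\beta)=(x\alpha)\beta$. The semigroup $\mathscr{I}_\lambda^n(S)$ consists of all maps $\alpha_S\colon \mathrm{Gr}(\alpha)\to S$, where $\alpha\in\mathscr{I}_\lambda^n$ and $\mathrm{Gr}(\alpha)\subset\lambda\times\lambda$ is the graph of $\alpha$; the element with empty graph is denoted $0$. The product $\alpha_S\cdot\beta_S$ has as underlying partial map the composition $\alpha\beta$, and if $(a,b)\in\mathrm{Gr}(\alpha)$ is sent to $s$ by $\alpha_S$ and $(b,d)\in\mathrm{Gr}(\beta)$ is sent to $t$ by $\beta_S$, then $\alpha_S\cdot\beta_S$ sends $(a,d)$ to $st$; in particular the product is $0$ if $\alpha\beta$ is empty. *)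

(* Defs.v *)
From HB Require Import structures.
From mathcomp Require Import all_boot.
From mathcomp Require Import boolp classical_sets functions cardinality.

Set Implicit Arguments.
Unset Strict Implicit.
Unset Printing Implicit Defensive.

Import Algebra.

Local Open Scope classical_set_scope.
Local Open Scope card_scope.
Local Open Scope group_scope.

Section Stable.
Variable T : semigroupType.

Definition left_stable : Prop := forall a b : T,
  [set t * a | t in [set: T]] `<=` [set t * (a * b) | t in [set: T]] ->
  [set t * a | t in [set: T]] = [set t * (a * b) | t in [set: T]].

Definition right_stable : Prop := forall c d : T,
  [set c * t | t in [set: T]] `<=` [set (d * c) * t | t in [set: T]] ->
  [set c * t | t in [set: T]] = [set (d * c) * t | t in [set: T]].

Definition stable : Prop := left_stable /\ right_stable.

End Stable.

(* A partial map from L to L is a function L -> option L, undefined at x when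
   its value is None. *)
Section PartialMap.
Variable L : Type.
Implicit Type f : L -> option L.

Definition graph f : set (L * L) := [set p | f p.1 = Some p.2].

Definition prange f : set L := [set y | exists x, f x = Some y].

Definition pinjective f : Prop :=
  forall x x' y, f x = Some y -> f x' = Some y -> x = x'.

End PartialMap.

Section PartialInjections.
Variables (L : Type) (n : nat).

Record pinj := PInj {
  pinj_fun :> L -> option L;
  pinj_inj : pinjective pinj_fun;
  pinj_rank : prange pinj_fun #<= `I_n
}.

Lemma pinj_ext (f g : pinj) : f =1 g -> f = g.
Proof.
case: f g => [f fi fr] [g gi gr] /= /funext fg.
by subst g; congr PInj; exact: Prop_irrelevance.
Qed.

(* Maps act on the right: x (f g) = (x f) g. *)
Section Composition.
Variables f g : pinj.

Lemma pinj_comp_inj : pinjective (pcomp g f).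
Proof.
move=> x x' y; rewrite /pcomp; case fx: (f x) => [u|] //= gu.
case fx': (f x') => [u'|] //= gu'.
by apply: pinj_inj fx _; rewrite (pinj_inj gu gu').
Qed.

Lemma pinj_comp_rank : prange (pcomp g f) #<= `I_n.
Proof.
apply: card_le_trans (pinj_rank g); apply: subset_card_le => y [x].
by rewrite /pcomp; case: (f x) => [u|] //= gu; exists u.
Qed.

Definition pinj_comp : pinj := PInj pinj_comp_inj pinj_comp_rank.

End Composition.

Lemma pinj_compA : associative pinj_comp.
Proof.
by move=> f g h; apply: pinj_ext => x /=; rewrite /pcomp /=; case: (f x).
Qed.

HB.instance Definition _ := gen_eqMixin pinj.
HB.instance Definition _ := gen_choiceMixin pinj.
HB.instance Definition _ := isSemigroup.Build pinj pinj_compA.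

End PartialInjections.

Section LabelledPartialInjections.
Variables (L : Type) (n : nat) (S : semigroupType).

Record lpinj := LPInj {
  under : pinj L n;
  label : graph under -> S
}.
Implicit Types a b c : lpinj.

Lemma graph_comp (f g : pinj L n) (p : graph (f * g)) :
  exists y,
    ((val p).1, y) \in graph f /\ (y, (val p).2) \in graph g.
Proof.
case: p => -[x z] /=; rewrite inE /graph /= /pcomp.
by case fx: (f x) => [y|] //= gy; exists y; rewrite !inE.
Qed.

Definition lpinj_mul a b : lpinj :=
  @LPInj (under a * under b) (fun p =>
    let: exist y (conj xy yz) := cid (graph_comp p) in
    label (exist _ ((val p).1, y) xy) * label (exist _ (y, (val p).2) yz)).

(* [labelled a x y s]: (x, y) lies in the graph of a and is sent to s. *)
Definition labelled a x y s : Prop :=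
  exists xy : (x, y) \in graph (under a), label (exist _ (x, y) xy) = s.

Lemma labelled_mul a b x z u :
  labelled (lpinj_mul a b) x z u <->
  exists y s t, [/\ labelled a x y s, labelled b y z t & u = s * t].
Proof.
split=> [[xz <-] /=|[y [s [t [[xy <-] [yz <-] ->]]]]].
  case: cid => y [xy yz]; exists y.
  by do 2!eexists; split; [exists xy | exists yz |].
have xz : (x, z) \in graph (under a * under b).
  by move: xy yz; rewrite !inE /graph /= /pcomp => -> /=.
exists xz => /=; case: cid => y' [xy' yz'] /=.
have yy' : y' = y by move: xy xy'; rewrite !inE /graph /= => -> [].
by subst y'; rewrite (bool_irrelevance xy' xy) (bool_irrelevance yz' yz).
Qed.

Lemma lpinj_ext a b :
  (forall x y s, labelled a x y s <-> labelled b x y s) -> a = b.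
Proof.
case: a b => [f l] [g m] E.
have fg : f = g.
  apply: pinj_ext => x; case fx: (f x) => [y|].
    have xy : (x, y) \in graph f by rewrite inE.
    have /E[/= + _] : labelled (LPInj l) x y (l (exist _ (x, y) xy)).
      by exists xy.
    by rewrite inE /graph /= => ->.
  case gx: (g x) => [y|] //.
  have xy : (x, y) \in graph g by rewrite inE.
  have /E[/= + _] : labelled (LPInj m) x y (m (exist _ (x, y) xy)).
    by exists xy.
  by rewrite inE /graph /= fx.
subst g; congr LPInj; apply/funext => -[[x y] xy].
have /E[/= xy' <-] :
    labelled (LPInj l) x y (l (exist _ (x, y) xy)) by exists xy.
by rewrite (bool_irrelevance xy' xy).
Qed.

Lemma lpinj_mulA : associative lpinj_mul.
Proof.
move=> a b c; apply: lpinj_ext => x z u; split.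
  move=> /labelled_mul[y [s [t [ha /labelled_mul[w [s' [t' [hb hc ->]]]] ->]]]].
  apply/labelled_mul; exists w, (s * s'), t'; rewrite mulgA; split=> //.
  by apply/labelled_mul; exists y, s, s'.
move=> /labelled_mul[y [s [t [/labelled_mul[w [s' [t' [ha hb ->]]]] hc ->]]]].
apply/labelled_mul; exists w, s', (t' * t); rewrite mulgA; split=> //.
by apply/labelled_mul; exists y, t', t.
Qed.

HB.instance Definition _ := gen_eqMixin lpinj.
HB.instance Definition _ := gen_choiceMixin lpinj.
HB.instance Definition _ := isSemigroup.Build lpinj lpinj_mulA.

End LabelledPartialInjections.

(* Main.v *)
Require Import Defs.
From HB Require Import structures.
From mathcomp Require Import all_boot.
From mathcomp Require Import boolp classical_sets functions cardinality.

(** Write T for the semigroup of S-labelled partial injections of rank at most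
    n.  It is enough to treat right stability: inverting the graph of every
    labelled partial injection identifies the opposite of T with the semigroup
    of partial injections labelled by the opposite of S, so left stability is
    right stability of the opposite semigroups ([left_stable_opp],
    [lpinj_inv_mul]), and stability is the conjunction of the two.

    The right ideal cT can be read off label by label: r belongs to cT exactly
    when each label of r, at (x, z) say, lies in sS, where s is the label that
    c puts at x ([rideal_lpinjP]).

    If T is right stable, so is S: the one-point elements at a fixed pair
    (e, e) turn an inclusion of principal right ideals of S into one of T.

    Conversely, let S be right stable and let cT be included in dcT.  Testing
    the inclusion on one-point elements shows that whenever c labels x by s,
    the map d sends x, with a label u, to a point labelled by s' under c, and
    sS is included in us'S ([rideal_sub_step]).  So d acts on the domain of c,
    which is finite, and it is injective, hence every point of the domain
    returns to itself ([iter_inj_periodic]).  Multiplying the inclusions along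
    such a cycle gives sS <= us'S <= DsS for a single element D of S, and right
    stability of S collapses the chain: us'S = sS.  As the domain of dc consists
    of points sent by d into the domain of c, periodicity also shows that it is
    contained in the domain of c.  Label by label this says that dcT is included
    in cT. *)

Set Implicit Arguments.
Unset Strict Implicit.
Unset Printing Implicit Defensive.

Import Algebra.

Local Open Scope classical_set_scope.
Local Open Scope card_scope.
Local Open Scope group_scope.

(** * Periodicity of injective self-maps of finite sets *)

Lemma iter_inj_periodic (T : Type) (A : set T) (f : T -> T) (x : T) :
  finite_set A -> {homo f : y / A y} ->
  (forall y z, A y -> A z -> f y = f z -> y = z) ->
  A x -> exists k, iter k.+1 f x = x.
Proof.
move=> finA fA finj Ax.
have itA i : A (iter i f x) by elim: i => //= i; exact: fA.
have cancel_iter i k : iter (i + k) f x = iter i f x -> iter k f x = x.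
  by elim: i => //= i IH /(finj _ _ (itA _) (itA _)) /IH.
apply: contrapT => noperiod.
have lt_neq i j : (i < j)%N -> iter j f x <> iter i f x.
  move=> ij E; apply: noperiod; exists (j - i.+1)%N; apply: (cancel_iter i).
  by rewrite addnS -addSn subnKC.
have itinj : {in [set: nat] &, injective (fun i => iter i f x)}.
  move=> i j _ _ E; case: (ltngtP i j) => [ij|ji|//].
    by case: (lt_neq _ _ ij).
  by case: (lt_neq _ _ ji).
apply: infinite_nat.
have /card_eqPle[_ natle] := inj_card_eq itinj.
apply: card_le_finite natle _; apply: sub_finite_set finA.
by move=> _ [i _ <-].
Qed.

(** * Principal one-sided ideals and the opposite semigroup *)

(** The set aT; in a semigroup without identity it need not contain a. *)
Definition rideal (T : semigroupType) (a : T) : set T :=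
  [set a * t | t in [set: T]].

Section RightIdeals.
Variable T : semigroupType.
Implicit Types a b c : T.

Lemma rideal_mulr a t : rideal a (a * t).
Proof. by exists t. Qed.

Lemma rideal_mul_sub a b c :
  rideal a `<=` rideal b -> rideal (c * a) `<=` rideal (c * b).
Proof.
move=> ab _ [t _ <-]; have [u _ E] := ab _ (rideal_mulr a t).
by exists u => //; rewrite -!mulgA E.
Qed.

End RightIdeals.

Definition opp_semigroup (S : semigroupType) : Type := S.

HB.instance Definition _ (S : semigroupType) :=
  Choice.copy (opp_semigroup S) S.

Definition opp_mul (S : semigroupType) (a b : opp_semigroup S) :
  opp_semigroup S := (b : S) * (a : S).

Lemma opp_mulA (S : semigroupType) : associative (@opp_mul S).
Proof. by move=> a b c; rewrite /opp_mul mulgA. Qed.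

HB.instance Definition _ (S : semigroupType) :=
  isSemigroup.Build (opp_semigroup S) (@opp_mulA S).

Lemma left_stable_opp (S : semigroupType) :
  left_stable S <-> right_stable (opp_semigroup S).
Proof. by split=> st a b; exact: st. Qed.

Lemma right_stable_iso (T U : semigroupType) (f : T -> U) (g : U -> T) :
  cancel f g -> cancel g f -> {morph f : a b / a * b} ->
  right_stable U -> right_stable T.
Proof.
move=> fK gK fM stU c d.
have rE a : [set a * t | t in [set: T]] = f @^-1` rideal (f a).
  apply/seteqP; split=> [_ [t _ <-]|t [u _ E]].
    by exists (f t); rewrite // fM.
  by exists (g u) => //; apply: (can_inj fK); rewrite fM gK.
rewrite !rE fM => sub; congr (_ @^-1` _); apply: stU => u uc.
by have := sub (g u); rewrite /preimage /= gK; exact.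
Qed.

(** * Labelled partial injections as labelled relations *)

Section Labelled.
Variables (L : Type) (n : nat) (S : semigroupType).
Implicit Types a b c d r : lpinj L n S.

Lemma labelled_det a x y y' s s' :
  labelled a x y s -> labelled a x y' s' -> y = y' /\ s = s'.
Proof.
move=> [xy <-] [xy' <-].
have yy' : y = y' by move: xy xy'; rewrite !inE /graph /= => -> [].
by subst y'; rewrite (bool_irrelevance xy xy').
Qed.

Lemma labelled_inj a x x' y s s' :
  labelled a x y s -> labelled a x' y s' -> x = x'.
Proof. by move=> [+ _] [+ _]; rewrite !inE; exact: pinj_inj. Qed.

Lemma labelled_under a x y s : labelled a x y s -> under a x = Some y.
Proof. by case=> + _; rewrite inE. Qed.

Lemma under_labelled a x y :
  under a x = Some y -> exists s, labelled a x y s.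
Proof.
move=> axy; have xy : (x, y) \in graph (under a) by rewrite inE.
by exists (label (exist _ (x, y) xy)), xy.
Qed.

Definition ldom a : set L := [set x | exists y s, labelled a x y s].

Definition lran a : set L := [set y | exists x s, labelled a x y s].

Lemma lran_card a : lran a #<= `I_n.
Proof.
apply: card_le_trans (pinj_rank (under a)); apply: subset_card_le.
by move=> y [x [s /labelled_under]]; exists x.
Qed.

Lemma ldom_card a : ldom a #<= `I_n.
Proof.
have [[x0 _]|dom0] := pselect (ldom a !=set0); last first.
  have -> : ldom a = set0 by rewrite -subset0 => x ?; apply: dom0; exists x.
  exact: card_ge0.
pose pre y : L := if pselect (exists x, under a x = Some y) is left ex
  then sval (cid ex) else x0.
apply: card_le_trans (lran_card a).
apply: card_le_trans (card_image_le pre (lran a)).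
apply: subset_card_le => x [y [s axy]].
exists y; first by exists x, s.
rewrite /pre; case: pselect => [ex|[]]; last first.
  by exists x; exact: labelled_under axy.
case: (cid ex) => /= x' /under_labelled[s' ax'y]; exact: labelled_inj ax'y axy.
Qed.

Lemma labelled_mulg a b x z u : labelled (a * b) x z u <->
  exists y s t, [/\ labelled a x y s, labelled b y z t & u = s * t].
Proof. exact: labelled_mul. Qed.

(** Through this and [lpinj_ext] elements are built and compared as labelled
    relations, without manipulating proofs of membership in a graph. *)
Lemma lpinj_of_rel (R : L -> L -> S -> Prop) :
  (forall x y y' s s', R x y s -> R x y' s' -> y = y' /\ s = s') ->
  (forall x x' y s s', R x y s -> R x' y s' -> x = x') ->
  [set y | exists x s, R x y s] #<= `I_n ->
  exists a : lpinj L n S, forall x y s, labelled a x y s <-> R x y s.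
Proof.
move=> Rdet Rinj Rrank.
pose f x := if pselect (exists ys : L * S, R x ys.1 ys.2) is left ex
  then Some (sval (cid ex)).1 else None.
have fP x y : f x = Some y <-> exists s, R x y s.
  rewrite /f; case: pselect => [ex|nex]; last first.
    by split=> // -[s Rs]; case: nex; exists (y, s).
  case: (cid ex) => -[y' s'] /= R'; split=> [[<-]|[s Rs]]; first by exists s'.
  by have [-> _] := Rdet _ _ _ _ _ R' Rs.
have finj : pinjective f.
  by move=> x x' y /fP[s Rs] /fP[s' Rs']; exact: Rinj Rs Rs'.
have frank : prange f #<= `I_n.
  apply: card_le_trans Rrank; apply: subset_card_le => y [x /fP[s Rs]].
  by exists x, s.
have [|lab labP] := @choice (graph (PInj finj frank)) S
    (fun p s => R (val p).1 (val p).2 s).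
  by case=> p pf; apply/fP; have := pf; rewrite inE.
exists (LPInj lab) => x y s; split=> [[xy <-]|Rs]; first exact: labP (exist _ (x, y) xy).
have xy : (x, y) \in graph (PInj finj frank).
  by rewrite inE; apply/fP; exists s.
by exists xy; have [] := Rdet _ _ _ _ _ (labP (exist _ (x, y) xy)) Rs.
Qed.

Lemma lpinj_single (n_gt0 : (0 < n)%N) (x y : L) (s : S) :
  exists a : lpinj L n S, forall x' y' s',
    labelled a x' y' s' <-> [/\ x' = x, y' = y & s' = s].
Proof.
apply: (@lpinj_of_rel (fun x' y' s' => [/\ x' = x, y' = y & s' = s])).
- by move=> ? ? ? ? ? [_ -> ->] [_ -> ->].
- by move=> ? ? ? ? ? [-> _ _] [-> _ _].
apply: (@card_le_trans _ _ _ `I_1); last by rewrite card_le_II.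
apply: (@card_le_trans _ _ _ [set y]).
  by apply: subset_card_le => y' [? [? []]].
have -> : [set y] = (fun=> y) @` `I_1.
  by apply/seteqP; split=> [_ ->|_ [_ _ <-] //]; exists 0%N.
exact: card_image_le.
Qed.

(** * Principal right ideals of labelled partial injections *)

(** For the converse the multiplier is built label by label: if c sends x to y
    with label s and r sends x to z with a label v in sS, then the pair (y, z)
    is given a label t with st = v.  This is a partial injection with one label
    at each pair, because y determines x, which determines s, z and v, while t
    is a chosen function of s and v. *)
Lemma rideal_lpinjP c r : rideal c r <->
  forall x z v, labelled r x z v ->
    exists y s, labelled c x y s /\ rideal s v.
Proof.
split=> [[t _ <-] x z v /labelled_mulg[y [s [u [cxy _ ->]]]]|H].
  by exists y, s; split=> //; exact: rideal_mulr.
pose quot s v := xget v [set t : S | s * t = v].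
have quotP s v : rideal s v -> s * quot s v = v.
  by case=> t _ E; exact: (@xgetI _ v [set t | s * t = v] t).
pose R y z t := exists x s v,
  [/\ labelled c x y s, labelled r x z v & t = quot s v].
have [|||t tP] := @lpinj_of_rel R.
- move=> y z z' t t' [x [s [v [cxy rxz ->]]]] [x' [s' [v' [cxy' rxz' ->]]]].
  have E := labelled_inj cxy cxy'; subst x'.
  by have [_ ->] := labelled_det cxy cxy'; have [-> ->] := labelled_det rxz rxz'.
- move=> y y' z t t' [x [s [v [cxy rxz _]]]] [x' [s' [v' [cxy' rxz' _]]]].
  have E := labelled_inj rxz rxz'; subst x'.
  by have [-> _] := labelled_det cxy cxy'.
- apply: card_le_trans (lran_card r); apply: subset_card_le.
  by move=> z [y [t [x [s [v [_ rxz _]]]]]]; exists x, v.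
exists t => //; apply: lpinj_ext => x z w; split.
  move=> /labelled_mulg[y [s [u [cxy /tP[x' [s' [v [cxy' rxz ->]]]] ->]]]].
  have E := labelled_inj cxy cxy'; subst x'.
  have [_ <-] := labelled_det cxy cxy'.
  have [y' [s'' [cxy'' sv]]] := H _ _ _ rxz.
  have [_ E] := labelled_det cxy cxy''; subst s''.
  by rewrite quotP.
move=> rxz; have [y [s [cxy sv]]] := H _ _ _ rxz.
apply/labelled_mulg; exists y, s, (quot s w); split=> //; last by rewrite quotP.
by apply/tP; exists x, s, w.
Qed.

(** Multiplying c on the right by the one-point elements at (y, y) moves every
    element of sS into the label at x. *)
Lemma rideal_sub_step (n_gt0 : (0 < n)%N) c d x y s :
  rideal c `<=` rideal (d * c) -> labelled c x y s ->
  exists x' y' u s', [/\ labelled d x x' u, labelled c x' y' s'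
                       & rideal s `<=` rideal (u * s')].
Proof.
move=> sub cxy.
have step t : exists x' y' u s',
    [/\ labelled d x x' u, labelled c x' y' s' & rideal (u * s') (s * t)].
  have [p pP] := lpinj_single n_gt0 y y t.
  have cpx : labelled (c * p) x y (s * t).
    by apply/labelled_mulg; exists y, s, t; split=> //; apply/pP.
  have /sub/rideal_lpinjP/(_ _ _ _ cpx) := rideal_mulr c p.
  move=> [y' [v [/labelled_mulg[x' [u [s' [dx cx ->]]]] ?]]].
  by exists x', y', u, s'.
(* Any multiplier shows that d is defined at x; s is one at hand. *)
have [x' [y' [u [s' [dx cx _]]]]] := step s.
exists x', y', u, s'; split=> // _ [t _ <-].
have [x1 [y1 [u1 [s1 [dx1 cx1]]]]] := step t.
have [E <-] := labelled_det dx dx1; subst x1.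
by have [_ <-] := labelled_det cx cx1.
Qed.

Lemma right_stable_lpinj (n_gt0 : (0 < n)%N) :
  right_stable S -> right_stable (lpinj L n S).
Proof.
move=> stS c d; rewrite -!/(rideal _) => sub.
apply/seteqP; split=> // r /rideal_lpinjP rP; apply/rideal_lpinjP => x z v rxz.
have [y [w [/labelled_mulg[x' [u [s' [dx cx' ->]]]] sv]]] := rP _ _ _ rxz.
pose next p := odflt p (under d p).
have nextE p q t : labelled d p q t -> next p = q.
  by rewrite /next => /labelled_under ->.
have domd p : ldom c p -> exists t, labelled d p (next p) t.
  move=> [q [s cpq]].
  have [p' [_ [t [_ [dp _ _]]]]] := rideal_sub_step n_gt0 sub cpq.
  by exists t; rewrite (nextE _ _ _ dp).
have next_dom : {homo next : p / ldom c p}.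
  move=> p [q [s cpq]].
  have [p' [q' [t [s2 [dp cp' _]]]]] := rideal_sub_step n_gt0 sub cpq.
  by rewrite (nextE _ _ _ dp); exists q', s2.
have next_inj p q : ldom c p -> ldom c q -> next p = next q -> p = q.
  move=> /domd[t dt] /domd[t' dt'] E; rewrite -E in dt'.
  exact: labelled_inj dt dt'.
have dom_fin : finite_set (ldom c).
  by apply/finite_set_leP; exists n; exact: ldom_card.
have dom_x' : ldom c x' by exists y, s'.
have [k per] := iter_inj_periodic dom_fin next_dom next_inj dom_x'.
have dom_iter i : ldom c (iter i next x').
  by elim: i => //= i; exact: next_dom.
(* The predecessor of x' on its cycle is x, because d is injective. *)
have xE : iter k next x' = x.
  have [t] := domd _ (dom_iter k); rewrite -iterS per => dt.
  exact: labelled_inj dt dx.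
(* Composing the inclusions along the cycle from x' back to x. *)
have chain i : exists D q si,
    labelled c (iter i next x') q si /\ rideal (u * s') `<=` rideal (D * si).
  elim: i => [|i [D [q [si [ci subi]]]]]; first by exists u, y, s'; split=> // ?.
  have [p' [q' [t [s2 [dt ct subt]]]]] := rideal_sub_step n_gt0 sub ci.
  exists (D * t), q', s2; rewrite iterS (nextE _ _ _ dt); split=> //.
  by apply: subset_trans subi _; rewrite -mulgA; exact: rideal_mul_sub.
have [D [q [s [cxq subD]]]] := chain k; rewrite xE in cxq.
have [x1 [y1 [u1 [s1 [dx1 cx1 subu]]]]] := rideal_sub_step n_gt0 sub cxq.
have [E E'] := labelled_det dx dx1; subst x1 u1.
have [_ E] := labelled_det cx' cx1; subst s1.
exists q, s; split=> //.
have eqD : rideal s = rideal (D * s).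
  by apply: stS; exact: subset_trans subu subD.
by rewrite eqD; exact: subD.
Qed.

Lemma right_stable_label (e : L) (n_gt0 : (0 < n)%N) :
  right_stable (lpinj L n S) -> right_stable S.
Proof.
move=> stT c d; rewrite -!/(rideal _) => sub.
have [c1 c1P] := lpinj_single n_gt0 e e c.
have [d1 d1P] := lpinj_single n_gt0 e e d.
have dc1 : labelled (d1 * c1) e e (d * c).
  by apply/labelled_mulg; exists e, d, c; split=> //; [apply/d1P | apply/c1P].
have eq1 : rideal c1 = rideal (d1 * c1).
  apply: stT => r /rideal_lpinjP rP; apply/rideal_lpinjP => x z v.
  move=> /rP[y [s [/c1P[-> _ ->] /sub cv]]].
  by exists e, (d * c).
apply/seteqP; split=> // _ [t _ <-].
have [p pP] := lpinj_single n_gt0 e e t.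
have := rideal_mulr (d1 * c1) p; rewrite -eq1 => /rideal_lpinjP H.
have /H[y [s [/c1P[_ _ ->]]]] // : labelled (d1 * c1 * p) e e (d * c * t).
by apply/labelled_mulg; exists e, (d * c), t; split=> //; apply/pP.
Qed.

Lemma right_stable_lpinjE (L_neq0 : [set: L] !=set0) (n_gt0 : (0 < n)%N) :
  right_stable (lpinj L n S) <-> right_stable S.
Proof.
have [e _] := L_neq0; split; first exact: right_stable_label.
exact: right_stable_lpinj.
Qed.

End Labelled.

(** * Inversion and the opposite semigroup *)

Section Inversion.
Variables (L : Type) (n : nat).

(** The relabelling h lets one construction serve as the inversion from labels
    in S to labels in the opposite of S, and as its inverse. *)
Lemma lpinj_inv_subproof (S S' : semigroupType) (h : S -> S')
    (a : lpinj L n S) :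
  exists b : lpinj L n S', forall y x s,
    labelled b y x s <-> exists2 r, labelled a x y r & s = h r.
Proof.
apply: (@lpinj_of_rel _ _ _
  (fun y x s => exists2 r, labelled a x y r & s = h r)).
- move=> y x x' s s' [r axy ->] [r' axy' ->].
  have E := labelled_inj axy axy'; subst x'.
  by have [_ ->] := labelled_det axy axy'.
- move=> y y' x s s' [r axy _] [r' axy' _].
  by have [] := labelled_det axy axy'.
apply: card_le_trans (ldom_card a); apply: subset_card_le.
by move=> x [y [s [r axy _]]]; exists y, r.
Qed.

Definition lpinj_inv (S S' : semigroupType) (h : S -> S') (a : lpinj L n S) :
  lpinj L n S' := sval (cid (lpinj_inv_subproof h a)).

Lemma labelled_inv (S S' : semigroupType) (h : S -> S') (a : lpinj L n S)
    y x s :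
  labelled (lpinj_inv h a) y x s <-> exists2 r, labelled a x y r & s = h r.
Proof. by rewrite /lpinj_inv; case: cid => b /=. Qed.

Lemma lpinj_invK (S S' : semigroupType) (h : S -> S') (h' : S' -> S) :
  cancel h h' -> cancel (@lpinj_inv S S' h) (lpinj_inv h').
Proof.
move=> hK a; apply: lpinj_ext => x y s; split.
  by move=> /labelled_inv[r /labelled_inv[r' ? ->] ->]; rewrite hK.
move=> axy; apply/labelled_inv; exists (h s); last by rewrite hK.
by apply/labelled_inv; exists s.
Qed.

Lemma lpinj_inv_mul (S S' : semigroupType) (h : S -> S') (a b : lpinj L n S) :
  (forall s t, h (s * t) = h t * h s) ->
  lpinj_inv h (a * b) = lpinj_inv h b * lpinj_inv h a.
Proof.
move=> hM; apply: lpinj_ext => z x w; split.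
  move=> /labelled_inv[r /labelled_mulg[y [s [t [axy byz ->]]]] ->].
  apply/labelled_mulg; exists y, (h t), (h s); split=> //.
    by apply/labelled_inv; exists t.
  by apply/labelled_inv; exists s.
move=> /labelled_mulg[y [t1 [s1 [/labelled_inv[t byz Et] hs ->]]]].
have [s axy Es] := (labelled_inv _ _ _ _ _).1 hs.
apply/labelled_inv; exists (s * t); last by rewrite Et Es hM.
by apply/labelled_mulg; exists y, s, t.
Qed.

Lemma left_stable_lpinj_opp (S : semigroupType) :
  left_stable (lpinj L n S) <-> right_stable (lpinj L n (opp_semigroup S)).
Proof.
pose f : opp_semigroup (lpinj L n S) -> lpinj L n (opp_semigroup S) :=
  lpinj_inv (id : S -> opp_semigroup S).
pose g : lpinj L n (opp_semigroup S) -> opp_semigroup (lpinj L n S) :=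
  lpinj_inv (id : opp_semigroup S -> S).
have fK : cancel f g by exact: lpinj_invK.
have gK : cancel g f by exact: lpinj_invK.
have fM : {morph f : a b / a * b} by move=> a b; exact: lpinj_inv_mul.
have gM : {morph g : a b / a * b}.
  by move=> a b; apply: (can_inj fK); rewrite fM !gK.
apply: iff_trans (left_stable_opp _) _.
by split; [exact: right_stable_iso gK fK gM | exact: right_stable_iso fK gK fM].
Qed.

End Inversion.

Theorem proposition3p11 (S : semigroupType) (L : Type) (n : nat)
    (L_neq0 : [set: L] !=set0) (n_gt0 : (0 < n)%N)
    (n_le_L : `I_n #<= [set: L]) :
  [/\ right_stable (lpinj L n S) <-> right_stable S,
      left_stable (lpinj L n S) <-> left_stable S
    & stable (lpinj L n S) <-> stable S].
Proof.
have rightE := right_stable_lpinjE S L_neq0 n_gt0.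
have leftE : left_stable (lpinj L n S) <-> left_stable S.
  apply: iff_trans (left_stable_lpinj_opp _ _ _) _.
  apply: iff_trans (right_stable_lpinjE _ L_neq0 n_gt0) _.
  exact: iff_sym (left_stable_opp S).
by split=> //; rewrite /stable rightE leftE.
Qed.
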